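(* Let $Z=(X,Y)$ be a non-smooth vector field (NSVF) on a compact 2-dimensional surface $M$, let $\Omega$ be the set of all global trajectories of $Z$, and define $\rho:\Omega\times\Omega\to\mathbb{R}$ by $$\rho(\gamma_1,\gamma_2)=\sum_{i\in\mathbb{Z}}\frac{1}{2^{|i|}}\int_i^{i+1}|\gamma_1(t)-\gamma_2(t)|\,dt,$$ where $|\gamma_1(t)-\gamma_2(t)|$ denotes the distance between the points $\gamma_1(t)$ and $\gamma_2(t)$. Then $(\Omega,\rho)$ is a metric space.
   Context: NSVF. Let $f$ be a real-valued $C^r$ function on $M$ ($r>1$ large enough) having $0$ as a regular value; $\Sigma=f^{-1}(0)$, $\Sigma^{+}=\{f>0\}$, $\Sigma^{-}=\{f<0\}$. A NSVF $Z=(X,Y)$ is given by $Z=X$ on $\Sigma^+$ and $Z=Y$ on $\Sigma^-$, where $X,Y$ are $C^r$ vector fields on $\overline{\Sigma^+}$, $\overline{\Sigma^-}$ (extendable to $C^r$ vector fields on open sets containing them), with flows $\phi_X,\phi_Y$. Put $Xf(p)=\langle\nabla f(p),X(p)\rangle$, $X^2f(p)=\langle\nabla (Xf)(p),X(p)\rangle$, and similarly for $Y$. Regions of $\Sigma$: $\Sigma^{c+}=\{Xf>0,Yf>0\}$, $\Sigma^{c-}=\{Xf<0,Yf<0\}$ (crossing); $\Sigma^{s}=\{Xf<0,Yf>0\}$ (sliding); $\Sigma^{e}=\{Xf>0,Yf<0\}$ (escaping). A tangency point is $p\in\Sigma$ with $Xf(p)\,Yf(p)=0$. A fold of $X$ is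 a point with $Xf(p)=0\ne X^2f(p)$; it is visible if $X^2f(p)>0$ and invisible if $X^2f(p)<0$; for $Y$ the two inequalities are interchanged. A tangency point is singular if it is an invisible tangency for both $X$ and $Y$, and regular otherwise. The sliding vector field on $\Sigma^s\cup\Sigma^e$ is $Z^s=\dfrac{(Yf)X-(Xf)Y}{Yf-Xf}$, extended to $\overline{\Sigma^s}\cup\overline{\Sigma^e}$. Local trajectories through $p$ ($t$ in an interval $I\ni 0$, origin of time at $p$; $\phi_X$, $\phi_Y$, $\phi_{Z^s}$ are followed while they remain in $\overline{\Sigma^+}$, $\overline{\Sigma^-}$, $\overline{\Sigma^s}\cup\overline{\Sigma^e}$ respectively): (i) $\phi_X$ if $p\in\Sigma^+$, $\phi_Y$ if $p\in\Sigma^-$; (ii) if $p\in\Sigma^{c+}$: $\phi_Y$ for $t\le0$ and $\phi_X$ for $t\ge0$; if $p\in\Sigma^{c-}$ the same reversing time; (iii) if $p\in\Sigma^e$: $\phi_{Z^s}$ for $t\le 0$ and any one of $\phi_X,\phi_Y,\phi_{Z^s}$ for $t\ge0$; if $p\in\Sigma^s$ the same reversing time; (iv) if $p$ is a regular tangency: $\phi_1$ for $t\le0$ and $\phi_2$ for $t\ge0$, each of $\phi_1,\phi_2$ being any of $\phi_X,\phi_Y,\phi_{Z^s}$; (v) if $p$ is a singular tangency: constantly $p$ for all $t\in\mathbb{R}$. A global trajectory is a curve $\gamma$ defined on $\mathbb{R}$ that is an orientation-preserving concatenation of local trajectories $\sigma_i$ on $[t_i,t_{i+1}]$, $i\in\mathbb{Z}$,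 with matching endpoints and $t_i\to\pm\infty$ as $i\to\pm\infty$. *)

(* Defs.v *)
From HB Require Import structures.
From mathcomp Require Import all_boot all_order all_algebra.
From mathcomp Require Import all_classical all_reals all_analysis.

Set Implicit Arguments.
Unset Strict Implicit.
Unset Printing Implicit Defensive.

Import Order.TTheory GRing.Theory Num.Theory.
Import numFieldNormedType.Exports.

Local Open Scope classical_set_scope.
Local Open Scope ring_scope.

(* [g] is of class C^k on the open set [U]: all iterated partial derivatives
   of order at most [k] exist and are continuous on [U].  Values of [g]
   outside [U] are irrelevant. *)
Fixpoint Ck (R : realType) (W : normedModType R) (k : nat)
    (U : set 'rV[R]_2) (g : 'rV[R]_2 -> W) : Prop :=
  {in U, continuous g} /\
  if k is k'.+1 then
    forall i : 'I_2,
      (forall x, U x -> derivable g x (delta_mx 0 i)) /\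
      Ck k' U (fun x => 'D_(delta_mx 0 i) g x)
  else True.

(* A homeomorphism [fwd], with inverse [inv], from the open set [dom] onto an
   open subset of the plane; [fwd] and [inv] are junk outside these sets. *)
Record chart (R : realType) (T : topologicalType) := Chart {
  dom : set T ;
  fwd : T -> 'rV[R]_2 ;
  inv : 'rV[R]_2 -> T ;
  dom_open : open dom ;
  img_open : open (fwd @` dom) ;
  fwdK : {in dom, cancel fwd inv} ;
  fwd_continuous : {within dom, continuous fwd} ;
  inv_continuous : {within fwd @` dom, continuous inv}
}.

(* A compact surface without boundary, with a differentiable structure of
   class C^(r+1), the weakest one for which "C^r vector field" is meaningful.
   Its distance is any distance inducing the topology of the surface. *)
Record surface (R : realType) (r : nat) := Surface {
  surf_pt :> metricType R ;
  surf_compact : compact [set: surf_pt] ;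
  atlas : set (chart R surf_pt) ;
  chart_at : surf_pt -> chart R surf_pt ;
  chart_at_atlas : forall p, atlas (chart_at p) ;
  mem_chart_at : forall p, dom (chart_at p) p ;
  atlas_compat : forall c c', atlas c -> atlas c' ->
    Ck r.+1 (fwd c @` (dom c `&` dom c')) (fwd c' \o inv c)
}.

Section Fields.
Context {R : realType} {r : nat} {M : surface R r}.

Definition Cr_fun (f : M -> R) : Prop :=
  forall c, atlas c -> Ck r (fwd c @` dom c) (f \o inv c).

(* A C^r vector field on the open set [vdom]: [vec c p] is the pair of
   components, in the chart [c], of the tangent vector attached to [p]; the
   components in two charts are related by the Jacobian of the transition. *)
Record vfield := VField {
  vdom : set M ;
  vec : chart R M -> M -> 'rV[R]_2 ;
  vdom_open : open vdom ;
  vec_compat : forall c c' p, atlas c -> atlas c' ->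
    vdom p -> dom c p -> dom c' p ->
    vec c' p = 'D_(vec c p) (fwd c' \o inv c) (fwd c p) ;
  vec_Cr : forall c, atlas c ->
    Ck r (fwd c @` (dom c `&` vdom)) (vec c \o inv c)
}.

(* <grad g, V>(p) = dg_p(V(p)), read in the chart at [p]; for differentiable
   [g] the value does not depend on the chart. *)
Definition lie (V : vfield) (g : M -> R) (p : M) : R :=
  let c := chart_at p in 'D_(vec V c p) (g \o inv c) (fwd c p).

End Fields.

Arguments vfield {R r} M.

Record nsvf (R : realType) (r : nat) (M : surface R r) := NSVF {
  nf : M -> R ;
  nX : vfield M ;
  nY : vfield M ;
  nf_Cr : Cr_fun nf ;
  nf_regular : forall p, nf p = 0 ->
    exists v : 'rV[R]_2,
      'D_v (nf \o inv (chart_at p)) (fwd (chart_at p) p) != 0 ;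
  nX_dom : closure [set p | 0 < nf p] `<=` vdom nX ;
  nY_dom : closure [set p | nf p < 0] `<=` vdom nY
}.

Section Trajectories.
Context {R : realType} {r : nat} {M : surface R r} (Z : nsvf M).

Definition Xf : M -> R := lie (nX Z) (nf Z).
Definition Yf : M -> R := lie (nY Z) (nf Z).
Definition X2f : M -> R := lie (nX Z) Xf.
Definition Y2f : M -> R := lie (nY Z) Yf.

Definition Sigma : set M := [set p | nf Z p = 0].
Definition Sigma_plus : set M := [set p | 0 < nf Z p].
Definition Sigma_minus : set M := [set p | nf Z p < 0].

Definition Sigma_cplus : set M := Sigma `&` [set p | 0 < Xf p /\ 0 < Yf p].
Definition Sigma_cminus : set M := Sigma `&` [set p | Xf p < 0 /\ Yf p < 0].
Definition Sigma_s : set M := Sigma `&` [set p | Xf p < 0 /\ 0 < Yf p].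
Definition Sigma_e : set M := Sigma `&` [set p | 0 < Xf p /\ Yf p < 0].

Definition tangency : set M := Sigma `&` [set p | Xf p * Yf p = 0].
Definition invisible_X : set M := Sigma `&` [set p | Xf p = 0 /\ X2f p < 0].
Definition invisible_Y : set M := Sigma `&` [set p | Yf p = 0 /\ 0 < Y2f p].
Definition singular_tangency : set M := tangency `&` (invisible_X `&` invisible_Y).
Definition regular_tangency : set M := tangency `\` singular_tangency.

(* Components in the chart [c] of the sliding vector field; meaningful on
   [Sigma_s `|` Sigma_e], where the denominator does not vanish. *)
Definition sliding (c : chart R M) (p : M) : 'rV[R]_2 :=
  (Yf p - Xf p)^-1 *: (Yf p *: vec (nX Z) c p - Xf p *: vec (nY Z) c p).

Definition sliding_closure : set M := closure Sigma_s `|` closure Sigma_e.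

(* [v] is the value at [p], read in [c], of the sliding vector field extended
   by continuity to [sliding_closure].  At a point of [Sigma_s `|` Sigma_e] the
   limit is [sliding c p]; at a point where no limit exists there is no value. *)
Definition sliding_ext (c : chart R M) (p : M) (v : 'rV[R]_2) : Prop :=
  sliding_closure p /\
  sliding c q @[q --> within (Sigma_s `|` Sigma_e) (nbhs p)] --> v.

(* On the time set [J] the curve [s] stays in [A] and is an integral curve of
   the field whose value at [p] in the chart [c] is the [v] such that [V c p v].
   The derivative is taken within [J], hence is one-sided at the end points. *)
Definition integral_curve (V : chart R M -> M -> 'rV[R]_2 -> Prop)
    (A : set M) (J : set R) (s : R -> M) : Prop :=
  {within J, continuous s} /\
  forall t, J t -> A (s t) /\
    let c := chart_at (s t) in
    exists2 v, V c (s t) v &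
      (u - t)^-1 *: (fwd c (s u) - fwd c (s t)) @[u --> within J t^'] --> v.

Definition follows_X : set R -> (R -> M) -> Prop :=
  integral_curve (fun c p v => v = vec (nX Z) c p) (closure Sigma_plus).
Definition follows_Y : set R -> (R -> M) -> Prop :=
  integral_curve (fun c p v => v = vec (nY Z) c p) (closure Sigma_minus).
Definition follows_Zs : set R -> (R -> M) -> Prop :=
  integral_curve sliding_ext sliding_closure.
Definition follows_any (J : set R) (s : R -> M) : Prop :=
  [\/ follows_X J s, follows_Y J s | follows_Zs J s].

Definition past (I : set R) : set R := I `&` [set t | t <= 0].
Definition future (I : set R) : set R := I `&` [set t | 0 <= t].

Variant local_rule (p : M) (I : set R) (s : R -> M) : Prop :=
| RulePlus of Sigma_plus p & follows_X I s
| RuleMinus of Sigma_minus p & follows_Y I s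
| RuleCplus of Sigma_cplus p & follows_Y (past I) s & follows_X (future I) s
| RuleCminus of Sigma_cminus p & follows_X (past I) s & follows_Y (future I) s
| RuleEscaping of Sigma_e p & follows_Zs (past I) s & follows_any (future I) s
| RuleSliding of Sigma_s p & follows_any (past I) s & follows_Zs (future I) s
| RuleRegular of regular_tangency p &
    follows_any (past I) s & follows_any (future I) s
| RuleSingular of singular_tangency p & I = setT & (forall t, s t = p).

(* [s] is a local trajectory through [p], defined on the interval [I]. *)
Definition local_trajectory (p : M) (I : set R) (s : R -> M) : Prop :=
  [/\ is_interval I, I 0, s 0 = p & local_rule p I s].

(* On each [tau i, tau (i+1)] the curve is a piece of a local trajectory, up to
   the choice [t0] of the origin of time; end points match because [g] is
   single-valued. *)
Definition global_trajectory (g : R -> M) : Prop :=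
  exists tau : int -> R,
    [/\ forall i, tau i < tau (i + 1),
        tau n%:Z @[n --> \oo] --> +oo,
        tau (- n%:Z) @[n --> \oo] --> -oo &
        forall i, exists p I s t0,
          local_trajectory p I s /\
          forall t, t \in `[tau i, tau (i + 1)] ->
            I (t - t0) /\ g t = s (t - t0)].

Definition Omega : set (R -> M) := [set g | global_trajectory g].

End Trajectories.

Section Rho.
Context {R : realType} {T : metricType R}.

Definition rho_ext (g1 g2 : R -> T) : \bar R :=
  (\esum_(i in [set: int])
    ((2 ^- `|i|%N)%:E *
     \int[lebesgue_measure]_(t in `[i%:~R, (i + 1)%:~R])
       (mdist (g1 t) (g2 t))%:E))%E.

Definition rho (g1 g2 : R -> T) : R := fine (rho_ext g1 g2).

End Rho.

(* The axioms of [isMetric], for a distance on a subset of a type. *)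
Definition metric_on (R : realType) (T : Type) (A : set T) (d : T -> T -> R)
    : Prop :=
  [/\ forall x y, A x -> A y -> 0 <= d x y,
      forall x y, A x -> A y -> (d x y = 0 <-> x = y),
      forall x y, A x -> A y -> d x y = d y x &
      forall x y z, A x -> A y -> A z -> d x z <= d x y + d y z].

(* Main.v *)
(* A local trajectory is made of integral curves agreeing at the origin of
   time, so it is continuous, and so is a global trajectory.  As [M] is compact,
   the distance is bounded by some [B], every integral is at most [B], and the
   series is dominated by the sum of [B / 2 ^ |i|].  If [rho g1 g2 = 0], every
   integral of the continuous function [mdist (g1 t) (g2 t)] vanishes, hence so
   does the function. *)
Require Import Defs.
From HB Require Import structures.
From mathcomp Require Import all_boot all_order all_algebra.
From mathcomp Require Import all_classical all_reals all_analysis.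
From mathcomp Require Import measurable_realfun ring lra.

Set Implicit Arguments.
Unset Strict Implicit.
Unset Printing Implicit Defensive.

Import Order.TTheory GRing.Theory Num.Theory.
Import numFieldNormedType.Exports.

Local Open Scope classical_set_scope.
Local Open Scope ring_scope.

(** * Time shifts, continuity and boundedness of the distance *)

Lemma within_continuous_shift (R : realType) (T : topologicalType)
    (A B : set R) (s : R -> T) (t0 : R) :
  (forall t, A t -> B (t - t0)) -> {within B, continuous s} ->
  {within A, continuous (fun t => s (t - t0))}.
Proof.
move=> AB /subspace_continuousP sB; apply/subspace_continuousP => x Ax.
apply: cvg_comp (sB _ (AB _ Ax)) => W.
have : (fun t => t - t0) @ x --> x - t0.
  by apply: cvgB; [exact: cvg_id|exact: cvg_cst].
move=> cv WB; have := cv _ WB; rewrite /within /= !nbhs_simpl /=.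
apply: filterS => t h At; exact/h/AB.
Qed.

Lemma continuous_mdist (R : realType) (S : topologicalType) (T : metricType R)
    (f g : S -> T) :
  continuous f -> continuous g -> continuous (fun t => mdist (f t) (g t)).
Proof.
move=> cf cg t; apply/cvgrPdist_lt => e e0.
have e2 : 0 < e / 2 by rewrite divr_gt0.
near=> u.
have fu : mdist (f t) (f u) < e / 2.
  by near: u; exact: metricType_numDomainType.cvgr_dist_lt (cf t) _ e2.
have gu : mdist (g t) (g u) < e / 2.
  by near: u; exact: metricType_numDomainType.cvgr_dist_lt (cg t) _ e2.
(* [h1] and [h2] bound [mdist (f t) (g t) - mdist (f u) (g u)] from above, [h3] and [h4] bound its
   opposite, in both cases by the sum of the displacements of [f] and [g], which is below [e]. *)
have h1 := metric_triangle (f t) (f u) (g t).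
have h2 := metric_triangle (f u) (g u) (g t).
have h3 := metric_triangle (f u) (f t) (g u).
have h4 := metric_triangle (f t) (g t) (g u).
rewrite (metric_sym (g u)) in h2; rewrite (metric_sym (f u) (f t)) in h3.
rewrite ltr_norml; apply/andP; split; lra.
Unshelve. all: by end_near. Qed.

(** The distance to a base point [p] attains its maximum at some [q], and passing through [p] gives
    twice this maximum as a bound. An empty space has no base point and is treated apart. *)
Lemma compact_mdist_bounded (R : realType) (T : metricType R) :
  compact [set: T] -> exists B : R, forall x y : T, mdist x y <= B.
Proof.
move=> cT; have [[p _]|T0] := pselect ([set: T] !=set0); last first.
  by exists 0 => x; exfalso; apply: T0; exists x.
have [||q _ qmax] := @compact_EVT_max T R (mdist p) setT _ cT.
- by exists p.
- apply: continuous_subspaceT; apply: continuous_mdist => x; first exact: cvg_cst.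
  exact: cvg_id.
exists (mdist p q + mdist p q) => x y.
apply: le_trans (metric_triangle x p y) _.
by rewrite metric_sym lerD// qmax// inE.
Qed.

(** * Continuity of local and global trajectories *)

Section Continuity.
Context {R : realType} {r : nat} {M : surface R r} {Z : nsvf M}.

Lemma follows_any_continuous (J : set R) (s : R -> M) :
  follows_any Z J s -> {within J, continuous s}.
Proof. by case=> -[]. Qed.

(** Pasting past and future at time 0 requires closed pieces. The interval [I] may fail to be
    closed, hence the restriction to a segment inside it. *)
Lemma local_rule_continuous (p : M) (I : set R) (s : R -> M) (a b : R) :
  local_rule Z p I s -> `[a, b] `<=` I -> {within `[a, b], continuous s}.
Proof.
move=> sI abI.
have glue : {within past I, continuous s} -> {within future I, continuous s} ->
    {within `[a, b], continuous s}.
  move=> sP sF.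
  have -> : [set` `[a, b]] =
      (`[a, b] `&` [set t | t <= 0]) `|` (`[a, b] `&` [set t | 0 <= t]).
    rewrite -setIUr; apply/esym/setIidPl => t _ /=.
    by have [|/ltW] := leP t 0; [left|right].
  apply: withinU_continuous.
  - by apply: closedI; [exact: itv_closed|exact: closed_le].
  - by apply: closedI; [exact: itv_closed|exact: closed_ge].
  - by apply: continuous_subspaceW sP; exact: setSI.
  - by apply: continuous_subspaceW sF; exact: setSI.
case: sI => [_ [sI _]|_ [sI _]|_ [sP _] [sF _]|_ [sP _] [sF _]
            |_ [sP _] sF|_ sP [sF _]|_ sP sF|_ _ sp].
- exact: continuous_subspaceW sI.
- exact: continuous_subspaceW sI.
- exact: glue.
- exact: glue.
- by apply: glue => //; exact: follows_any_continuous sF.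
- by apply: glue => //; exact: follows_any_continuous sP.
- by apply: glue; [exact: follows_any_continuous sP
                  |exact: follows_any_continuous sF].
- rewrite (_ : s = cst p); last exact/funext.
  by apply: continuous_subspaceT => t; exact: cvg_cst.
Qed.

Lemma global_trajectory_continuous (g : R -> M) :
  global_trajectory Z g -> continuous g.
Proof.
move=> [tau [tau_lt tau_y tau_Ny pieces]].
have piece i : {within `[tau i, tau (i + 1)], continuous g}.
  have [p [I [s [t0 [[_ _ _ sI] gs]]]]] := pieces i.
  apply: (@subspace_eq_continuous _ _ _ (fun t => s (t - t0))).
    by move=> t /set_mem tab; exact/esym/(gs t _).2.
  apply: (@within_continuous_shift _ _ _ `[tau i - t0, tau (i + 1) - t0]).
    by move=> t /=; rewrite !in_itv/= !lerD2r.
  apply: local_rule_continuous sI _ => t tab.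
  rewrite -(addrK t0 t); apply: (gs _ _).1.
  by move: tab; rewrite /= !in_itv/= lerBlDr lerBrDr.
(* Starting from the single point [tau 0], each induction step pastes one more piece on either
   side. *)
have union (n : nat) : {within `[tau (- n%:Z), tau n%:Z], continuous g}.
  elim: n => [|n IHn].
    by rewrite oppr0 set_itv1; exact: continuous_subspace1.
  have eL : - n.+1%:Z + 1 = - n%:Z by rewrite -addn1 PoszD opprD addrNK.
  have eR : n%:Z + 1 = n.+1%:Z by rewrite -addn1 PoszD.
  have /= pL := piece (- n.+1%:Z); rewrite eL in pL.
  have /= pR := piece n%:Z; rewrite eR in pR.
  apply: (@continuous_subspaceW _ _ _
    ((`[tau (- n.+1%:Z), tau (- n%:Z)] `|` `[tau (- n%:Z), tau n%:Z])
       `|` `[tau n%:Z, tau n.+1%:Z])); last first.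
    apply: withinU_continuous => //; [|exact: itv_closed|].
      by apply: closedU; exact: itv_closed.
    by apply: withinU_continuous => //; exact: itv_closed.
  move=> t /=; rewrite !in_itv/= => /andP[h1 h2].
  have [h3|/ltW h3] := leP t (tau n%:Z); last by right; apply/andP.
  by left; have [h4|/ltW h4] := leP t (tau (- n%:Z)); [left|right]; apply/andP.
move=> t.
(* The divergence of [tau] at both ends puts [t] in the interior of one of these segments, where
   continuity within the segment is plain continuity. *)
have [n [ltn gtn]] : exists n : nat, tau (- n%:Z) < t /\ t < tau n%:Z.
  near \oo => n; exists n; split; near: n.
    move/cvgrNyPlt : tau_Ny; exact.
  move/cvgryPgt : tau_y; exact.
have : {within `]tau (- n%:Z), tau n%:Z[, continuous g}.
  by apply: continuous_subspaceW (union n); exact: subset_itv_oo_cc.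
rewrite continuous_open_subspace; last exact: interval_open.
by apply; rewrite inE /= in_itv/= ltn.
Unshelve. all: by end_near. Qed.

End Continuity.

(** * Vanishing integrals and the geometric majorant *)

(** A nonzero value at [t] would persist on some []t, c[] inside [[a, b]], yet [f] vanishes almost
    everywhere there. As [t < b] leaves room on the right, [t = a] is not a special case. *)
Lemma continuous_integral_eq0 (R : realType) (f : R -> R) (a b t : R) :
  continuous f -> (forall x, 0 <= f x) ->
  (\int[lebesgue_measure]_(x in `[a, b]) (f x)%:E = 0)%E ->
  a <= t < b -> f t = 0.
Proof.
move=> cf f0 intf /andP[at_ tb]; apply/eqP; apply: contrapT => /negP ft.
have : ae_eq (@lebesgue_measure R) [set` `[a, b]] (EFin \o f) (cst 0%E).
  apply/ae_eq_integral_abs => //.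
    apply/measurable_EFinP.
    exact: measurable_funS (continuous_measurable_fun cf).
  by rewrite -[RHS]intf; apply: eq_integral => x _; rewrite /= ger0_norm.
have [c tc fc] : exists2 c, t < c & forall u, t < u < c -> u < b /\ f u != 0.
  have : \forall u \near t, u < b /\ f u != 0.
    near=> u; split; near: u; first exact: lt_nbhsl.
    exact: cvgr_neq0 (cf t) ft.
  move=> /nbhs_ballP[e /= e0 ball_sub]; exists (t + e); first by rewrite ltrDl.
  move=> u /andP[tu ut]; apply: ball_sub.
  by rewrite /ball/= ltr0_norm ?subr_lt0// opprB ltrBlDl.
move=> [N [mN N0 subN]].
(* All of []t, c[] lies in the exceptional null set [N], so its length [c - t] would be at most
   0. *)
have : (lebesgue_measure (`]t, c[ : set R) <= lebesgue_measure N)%E.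
  apply: le_measure; rewrite ?inE// => u /=; rewrite in_itv/= => tuc.
  have [ub fu] := fc _ tuc; apply: subN => /= h.
  case/andP: tuc => tu _.
  have /h : u \in `[a, b] by rewrite in_itv/= (ltW ub) (le_trans at_ (ltW tu)).
  by case=> fu0; rewrite fu0 eqxx in fu.
rewrite N0 lebesgue_measure_itv/= lte_fin tc lee_fin.
by rewrite subr_le0 leNgt tc.
Unshelve. all: by end_near. Qed.

Lemma esum_geometric_int_lty (R : realType) (B : R) :
  0 <= B -> (\esum_(i in [set: int]) (B * 2 ^- `|i|%N)%:E < +oo)%E.
Proof.
move=> B0.
have term_ge0 (i : int) : (0 <= (B * 2 ^- `|i|%N)%:E)%E.
  by rewrite lee_fin mulr_ge0// invr_ge0 exprn_ge0.
(* Each half of the integers is enumerated by some [e] along which the terms are [c / 2 ^ (n + 1)],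
   with sum [c]. Since [|Posz n| = n] and [|Negz n| = n + 1], the constant [c] is [2 * B] on the
   first half and [B] on the second. *)
have half_lty (e : nat -> int) (c : R) : injective e ->
    (forall n, B * 2 ^- `|e n|%N = c / (2 ^ (n + 1))%:R) ->
    (\esum_(i in range e) (B * 2 ^- `|i|%N)%:E < +oo)%E.
  move=> e_inj eE; rewrite esum_image; last by move=> m n _ _; exact: e_inj.
  rewrite -nneseries_esumT//.
  under eq_eseriesr do rewrite eE.
  by have /cvg_lim -> := @cvg_geometric_eseries_half R c 0; rewrite ?ltry.
rewrite (esumID (range Posz))// !setTI lte_add_pinfty//.
  apply: (half_lty _ (2 * B)) => [m n []//|n].
  by rewrite natrX addn1 exprS absz_nat; field.
rewrite (_ : ~` range Posz = range Negz); last first.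
  apply/seteqP; split => [[n|n] /= h|_ [n _ <-] [m _]//]; last by exists n.
  by exfalso; apply: h; exists n.
apply: (half_lty _ B) => [m n []//|n].
by rewrite natrX addn1.
Qed.

(** * The extended-real-valued distance between continuous curves *)

Section RhoContinuous.
Context {R : realType} {T : metricType R}.
Implicit Types f g h : R -> T.

Local Notation rho_int f g i :=
  (\int[lebesgue_measure]_(t in `[i%:~R, (i + 1)%:~R])
     (mdist (f t) (g t))%:E)%E.

Lemma measurable_mdist f g (D : set R) : continuous f -> continuous g ->
  measurable_fun D (fun t => (mdist (f t) (g t))%:E).
Proof.
move=> cf cg; apply/measurable_EFinP.
exact: measurable_funS (continuous_measurable_fun (continuous_mdist cf cg)).
Qed.

Lemma rho_int_ge0 f g (i : int) : (0 <= rho_int f g i)%E.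
Proof. by apply: integral_ge0 => t _; rewrite lee_fin mdist_ge0. Qed.

Lemma rho_term_ge0 f g (i : int) : (0 <= (2 ^- `|i|%N)%:E * rho_int f g i)%E.
Proof. by rewrite mule_ge0 ?rho_int_ge0// lee_fin invr_ge0 exprn_ge0. Qed.

Lemma rho_ext_ge0 f g : (0 <= rho_ext f g)%E.
Proof. by apply: esum_ge0 => i _; exact: rho_term_ge0. Qed.

Lemma integrable_mdist f g (i : int) : continuous f -> continuous g ->
  (@lebesgue_measure R).-integrable `[i%:~R, (i + 1)%:~R]
    (fun t => (mdist (f t) (g t))%:E).
Proof.
move=> cf cg; apply: continuous_compact_integrable; first exact: segment_compact.
by apply: continuous_subspaceT; exact: continuous_mdist.
Qed.

Lemma rho_ext_fin_num f g (B : R) : continuous f -> continuous g ->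
  (forall x y : T, mdist x y <= B) -> rho_ext f g \is a fin_num.
Proof.
move=> cf cg mB; rewrite ge0_fin_numE ?rho_ext_ge0//.
have B0 : 0 <= B := le_trans (mdist_ge0 (f 0) (f 0)) (mB _ _).
apply: le_lt_trans (esum_geometric_int_lty B0); apply: le_esum => i _.
rewrite mulrC EFinM lee_wpmul2l ?lee_fin ?invr_ge0 ?exprn_ge0//.
(* The domain of integration has length 1, so [B] is itself an integral over it and the integrands
   can be compared. *)
have -> : B%:E =
    (\int[lebesgue_measure]_(t in `[i%:~R, (i + 1)%:~R]) cst B%:E t)%E.
  rewrite integral_cst//= lebesgue_measure_itv/= lte_fin intrD ltrDl ltr01.
  by rewrite -EFinB addrC addKr mule1.
apply: ge0_le_integral => //; first by move=> t _; rewrite lee_fin mdist_ge0.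
- exact: measurable_mdist.
- by move=> t _; rewrite lee_fin.
Qed.

(** Everything is nonnegative and measurable, so sums and integrals are additive in the extended
    reals and the pointwise triangle inequality passes through without any finiteness. *)
Lemma rho_ext_triangle f g h : continuous f -> continuous g -> continuous h ->
  (rho_ext f h <= rho_ext f g + rho_ext g h)%E.
Proof.
move=> cf cg ch.
rewrite /rho_ext -esumD; [|by move=> *; exact: rho_term_ge0..].
apply: le_esum => i _.
rewrite -ge0_muleDr ?rho_int_ge0//.
rewrite lee_wpmul2l ?lee_fin ?invr_ge0 ?exprn_ge0//.
rewrite -ge0_integralD//; try exact: measurable_mdist;
  try by move=> t _; rewrite lee_fin mdist_ge0.
apply: ge0_le_integral => //; first by move=> t _; rewrite lee_fin mdist_ge0.
- exact: measurable_mdist.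
- by apply: emeasurable_funD; exact: measurable_mdist.
- by move=> t _; rewrite -EFinD lee_fin metric_triangle.
Qed.

Lemma rho_extC f g : rho_ext f g = rho_ext g f.
Proof.
apply: eq_esum => i _; congr (_ * _)%E.
by apply: eq_integral => t _; rewrite metric_sym.
Qed.

Lemma rho_extxx f : rho_ext f f = 0%E.
Proof.
apply: esum1 => i _; rewrite integral0_eq ?mule0// => t _.
by rewrite mdistxx.
Qed.

Lemma rho_ext_eq0 f g : continuous f -> continuous g ->
  rho_ext f g = 0%E -> f = g.
Proof.
move=> cf cg fg0; apply/funext => t; apply: mdist_positivity.
(* With this choice [t] lies in [[i, i + 1[], and the [i]-th term, being a finite partial sum of
   nonnegative terms, is at most the total 0. *)
pose i := Num.floor t.
have int0 : rho_int f g i = 0%E.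
  have : ((2 ^- `|i|%N)%:E * rho_int f g i <= 0)%E.
    rewrite -fg0; apply: esum_ge; exists [set i]; last by rewrite fsbig_set1.
    by split; [exact: finite_set1|].
  rewrite pmule_rle0 ?lte_fin ?invr_gt0 ?exprn_gt0// => int_le0.
  by apply/eqP; rewrite eq_le int_le0 rho_int_ge0.
apply: (continuous_integral_eq0 (continuous_mdist cf cg) _ int0).
  by move=> x; exact: mdist_ge0.
exact: floor_itv.
Qed.

End RhoContinuous.

(* The first two conjuncts say that [rho] is well defined: the integrals make
   sense and the series converges. *)
Theorem proposition4p1 (R : realType) (r : nat) (hr : (1 < r)%N)
    (M : surface R r) (Z : nsvf M) :
  [/\ forall g1 g2 : R -> M, Omega Z g1 -> Omega Z g2 -> forall i : int,
        (@lebesgue_measure R).-integrable `[i%:~R, (i + 1)%:~R]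
          (fun t => (mdist (g1 t) (g2 t))%:E),
      forall g1 g2 : R -> M, Omega Z g1 -> Omega Z g2 ->
        rho_ext g1 g2 \is a fin_num &
      metric_on (Omega Z) (@rho R M)].
Proof.
have cont g : Omega Z g -> continuous g := @global_trajectory_continuous R r M Z g.
have [B mB] := compact_mdist_bounded (@surf_compact R r M).
have fin g1 g2 : Omega Z g1 -> Omega Z g2 -> rho_ext g1 g2 \is a fin_num.
  by move=> /cont c1 /cont c2; exact: rho_ext_fin_num mB.
split=> [g1 g2 /cont c1 /cont c2 i||]; [exact: integrable_mdist|exact: fin|split].
- by move=> g1 g2 _ _; apply: fine_ge0; exact: rho_ext_ge0.
- move=> g1 g2 O1 O2; split=> [|<-]; last by rewrite /rho rho_extxx.
  (* [fine] also sends the infinities to 0, so finiteness is what turns [rho0] into the vanishing of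
     [rho_ext]. *)
  move=> rho0; apply: rho_ext_eq0; [exact: cont|exact: cont|].
  by rewrite -(fineK (fin _ _ O1 O2)) -/(rho g1 g2) rho0.
- by move=> g1 g2 _ _; rewrite /rho rho_extC.
- move=> g1 g2 g3 O1 O2 O3.
  rewrite -lee_fin EFinD /rho !fineK ?fin//.
  by apply: rho_ext_triangle; exact: cont.
Qed.
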